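(* Assume that the sampling vectors satisfy Assumption 1 (stated in the context), and that the measurements $b$ are corrupted by noise $\epsilon^{\mathrm{noise}}\in\mathbb{R}^m$, i.e. GPS with $g=0$ is run with $\tilde b=b+\epsilon^{\mathrm{noise}}$ in place of $b$. Let $\beta,\epsilon_1,\epsilon_2$ be the constants described in the context. If $\|z_{\mathrm{DR}}^1-z_*^1\|$ is small enough (i.e. below some positive threshold) but greater than the noise level $\|\epsilon^{\mathrm{noise}}\|$, and if furthermore $\|\epsilon^{\mathrm{noise}}\|$ is small enough that, for all $k\ge 1$, $z_{\mathrm{DR}}^k\in\mathcal V_k$ and $\|z_*^k-z^{\natural}\|\le\epsilon_2$, then for all $k\ge1$ $$\operatorname{dist}(x^k,x^{\natural})\le(\beta+\epsilon_1)^{k-1}\|z_{\mathrm{DR}}^1-z_*^1\|+\frac{1}{1-(\beta+\epsilon_1)}\|\epsilon^{\mathrm{noise}}\|.$$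
   Context: Setting. $A=[a_1,\dots,a_m]\in\mathbb{C}^{n\times m}$, $A^*$ is its conjugate transpose, $m\ge n$. $|\cdot|$, products $\circ$, quotients and inequalities of vectors are entrywise, with the convention $z_i/|z_i|=0$ if $z_i=0$. Norms are Euclidean (operator norms for operators). $b\in\mathbb{R}^m$ is the vector of noiseless measurements, $b_{\min}=\min_i b_i>0$. $x^{\natural}$ is the solution of $|A^*x|=b$, $y^{\natural}=A^*x^{\natural}$ (so $|y^{\natural}|=b$), $z^{\natural}=(x^{\natural},y^{\natural})\in\mathbb{C}^{n+m}$. $\operatorname{dist}(x,x^{\natural})=\min_{|\alpha|=1}\|x-\alpha x^{\natural}\|$. Assumption 1. (i) $A^*$ has full column rank. (ii) The solution of the phase retrieval problem $|a_i^*x|=b_i$, $i=1,\dots,m$, is unique up to the trivial ambiguities, including translation shift, mirror flipping and global phase shift (multiplication by a unimodular scalar); all of these are the general case for Fourier measurements, while global phase is the only ambiguity for Gaussian measurements; the solution up to these ambiguities is denoted $x^{\natural}$. (iii) The solution of the magnitude retrieval problem: find $x\in\mathbb{C}^n$ with $\frac{a_i^*x}{|a_i^*x|}=\pm\frac{a_i^*x^{\natural}}{|a_i^*x^{\natural}|}$ for $i=1,\dots,m$ (the sign may depend on $i$), is unique up to a constant magnitude factor, i.e. its solutions are $cx^{\natural}$, $c\in\mathbb{R}\setminus\{0\}$. GPS iteration with $g=0$ and noisy data. Let $\Pi_{A^*}$ be the orthogonal projection of $\mathbb{C}^{n+m}$ onto the graph $\{(x,y): A^*x=y\}$ and $\operatorname{prox}_f(y)=\tilde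 b\circ\frac{y}{|y|}$. Given $x^0,\lambda^0\in\mathbb{C}^n$, $y^0,\nu^0\in\mathbb{C}^m$, for $k\ge0$: $(x^{k+1/2},y^{k+1/2})=\Pi_{A^*}(x^k-\lambda^k,y^k-\nu^k)$; $x^{k+1}=x^{k+1/2}+\lambda^k$, $y^{k+1}=\operatorname{prox}_f(y^{k+1/2}+\nu^k)$; $\lambda^{k+1}=\lambda^k+x^{k+1/2}-x^{k+1}$, $\nu^{k+1}=\nu^k+y^{k+1/2}-y^{k+1}$. Put $z_{\mathrm{DR}}^k=(x_{\mathrm{DR}}^k,y_{\mathrm{DR}}^k)=(\lambda^k+x^k,\nu^k+y^k)$. Define $$\mathcal F=\left\{\begin{pmatrix}\alpha x^{\natural}\\ \alpha(b+\theta)\circ\frac{y^{\natural}}{|y^{\natural}|}\end{pmatrix}: |\alpha|=1,\ \theta\in\mathbb{R}^m,\ A\Big(\theta\circ\frac{y^{\natural}}{|y^{\natural}|}\Big)=0,\ b+\theta\ge0\right\},$$ $z_*^k=P_{\mathcal F}z_{\mathrm{DR}}^k\in\arg\min_{w\in\mathcal F}\|w-z_{\mathrm{DR}}^k\|$, written $z_*^k=\begin{pmatrix}\alpha_kx^{\natural}\\ \alpha_ky_*^k\end{pmatrix}$ with $y_*^k=(b+\theta_k)\circ\frac{y^{\natural}}{|y^{\natural}|}$, $|\alpha_k|=1$. $\mathcal V_k$ is the open ball of radius $b_{\min}/2$ centered at $\alpha_kz^{\natural}$. Constants. Let $I+AA^*=LL^*$ be the Cholesky decomposition, $C=(L^{-1},\,L^{-1}A)\in\mathbb{C}^{n\times(n+m)}$,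 $\Omega_x=\operatorname{diag}\big(\frac{\alpha_kx^{\natural}}{|x^{\natural}|}\big)$, $\Omega_y=\operatorname{diag}\big(\frac{\alpha_ky_*^k}{|y_*^k|}\big)$, $\Omega=\operatorname{diag}(\Omega_x,\Omega_y)$, $B=C\Omega$, and $v^k=\begin{pmatrix}\Omega_x^*(x_{\mathrm{DR}}^k-\alpha_kx^{\natural})\\ \Omega_y^*(y_{\mathrm{DR}}^k-\alpha_ky_*^k)\end{pmatrix}$. For $v=(p,q)\in\mathbb{C}^n\times\mathbb{C}^m$ let $$J_k(v)=(I-B^*B)v+(2B^*B-I)\begin{pmatrix}p\\ \operatorname{diag}\big(\tfrac{b}{b+\theta_k}\big)\,i\operatorname{Im}(q)\end{pmatrix},\qquad J_0(v)=(I-B^*B)v+(2B^*B-I)\begin{pmatrix}p\\ i\operatorname{Im}(q)\end{pmatrix}.$$ $\beta\in(0,1)$ is a constant such that $\|J_0(v^k)\|\le\beta\|v^k\|$ whenever $z_{\mathrm{DR}}^k\in\mathcal V_k$ (local contraction constant of the noiseless linearized iteration); $\epsilon_1>0$ is such that $\beta+\epsilon_1<1$; and $\epsilon_2>0$ (with $\epsilon_2<b_{\min}/3$) is such that $\|J_k-J_0\|\le\epsilon_1$ whenever $\|\theta_k\|\le\epsilon_2$.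
   Formalization: In Ω_x, zero entries of x^♮ are given phase 1 instead of the convention z/|z|=0, so that Ω is unitary; with 0 those coordinates drop out of v^k, J_0 and β, and the claimed rate can fail. Nothing changes when x^♮ has no zero entry. *)

(* Defs.v *)
From HB Require Import structures.
From mathcomp Require Import all_boot all_order all_algebra.
From mathcomp Require Import complex.
From mathcomp Require Import boolp classical_sets reals.

Set Implicit Arguments.
Unset Strict Implicit.
Unset Printing Implicit Defensive.
Import Order.TTheory GRing.Theory Num.Theory.
Local Open Scope ring_scope.
Local Open Scope complex_scope.
Local Open Scope sesquilinear_scope.
Local Open Scope classical_set_scope.

(* C^n is 'cV[R[i]]_n with R[i] the complex numbers over R : realType; the
   norm `|z| of z : R[i] is itself an element of R[i], hence the real-valued
   versions below.  C^(n+m) = C^n x C^m is 'cV[R[i]]_(n + m), its elements are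
   written col_mx x y, and the two parts of z are usubmx z and dsubmx z. *)

Section Vectors.
Variable R : realType.

Definition cabs (z : R[i]) : R := complex.Re `|z|.

Definition enorm p (v : 'cV[R[i]]_p) : R :=
  Num.sqrt (\sum_(i < p) cabs (v i 0) ^+ 2).

Definition enormR p (v : 'cV[R]_p) : R :=
  Num.sqrt (\sum_(i < p) v i 0 ^+ 2).

(* Operator norm for real-linear maps (J_k involves Im, so it is not
   complex-linear). *)
Definition opnorm p q (T : 'cV[R[i]]_p -> 'cV[R[i]]_q) : R :=
  sup [set enorm (T v) | v in [set v | enorm v <= 1]].

Definition toC p (v : 'cV[R]_p) : 'cV[R[i]]_p := \col_i (v i 0)%:C.

Definition hmul p (u v : 'cV[R[i]]_p) : 'cV[R[i]]_p :=
  \col_i (u i 0 * v i 0).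

(* Entrywise z / |z|; since x / 0 = 0, a zero entry has phase 0. *)
Definition phase p (v : 'cV[R[i]]_p) : 'cV[R[i]]_p :=
  \col_i (v i 0 / `|v i 0|).

(* As phase, except that a zero entry has phase 1. *)
Definition uphase p (v : 'cV[R[i]]_p) : 'cV[R[i]]_p :=
  \col_i (if v i 0 == 0 then 1 else v i 0 / `|v i 0|).

Definition bmin m (b : 'cV[R]_m) : R := inf [set b i 0 | i in [set: 'I_m]].

Definition dist p (x y : 'cV[R[i]]_p) : R :=
  inf [set enorm (x - a *: y) | a in [set a : R[i] | `|a| = 1]].

End Vectors.

Section PhaseRetrieval.
Variables (R : realType) (n m : nat).
Local Notation C := R[i].
Implicit Types (A : 'M[C]_(n, m)) (b theta : 'cV[R]_m) (x xnat : 'cV[C]_n).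

Definition phase_retrieval_sol A b x :=
  forall i, cabs ((A^t* *m x) i 0) = b i 0.

(* The equivalence generated by global phase, (periodic) translation and mirror
   flipping of the signal, where grid identifies the n entries of a vector with
   the points of a finite abelian group: Z/n for one-dimensional signals, a
   product of cyclic groups for images.  Mirror flipping is the reflection
   g |-> - g combined with complex conjugation, which is the reflection that
   preserves the Fourier magnitudes of a complex signal. *)
Inductive trivially_equivalent (G : finZmodType) (grid : 'I_n -> G) :
    'cV[C]_n -> 'cV[C]_n -> Prop :=
| TE_phase (a : C) x : `|a| = 1 -> trivially_equivalent grid x (a *: x)
| TE_shift (s : G) x x' :
    (forall i j, grid j = grid i + s -> x' j 0 = x i 0) ->
    trivially_equivalent grid x x'
| TE_flip x x' :
    (forall i j, grid j = - grid i -> x' j 0 = (x i 0)^*) ->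
    trivially_equivalent grid x x'
| TE_trans x x' x'' :
    trivially_equivalent grid x x' -> trivially_equivalent grid x' x'' ->
    trivially_equivalent grid x x''.

(* Uniqueness is only required up to all three kinds of ambiguity, so the case
   where the global phase is the only ambiguity is included. *)
Record assumption1 A b (G : finZmodType) (grid : 'I_n -> G) xnat : Prop := {
  full_column_rank : \rank (A^t*) = n;
  phase_retrieval_ex : phase_retrieval_sol A b xnat;
  phase_retrieval_uniq : forall x,
    phase_retrieval_sol A b x -> trivially_equivalent grid xnat x;
  magnitude_retrieval_uniq : forall x,
    (forall i, phase (A^t* *m x) i 0 = phase (A^t* *m xnat) i 0 \/
               phase (A^t* *m x) i 0 = - phase (A^t* *m xnat) i 0) <->
    exists c : R, c != 0 /\ x = c%:C *: xnat }.

Definition graph A : set 'cV[C]_(n + m) :=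
  [set z | A^t* *m usubmx z = dsubmx z].

Definition is_orth_proj p (S : set 'cV[C]_p) (z w : 'cV[C]_p) : Prop :=
  S w /\ forall u, S u -> u^t* *m (z - w) = 0.

Definition prox_f (bt : 'cV[R]_m) (y : 'cV[C]_m) : 'cV[C]_m :=
  hmul (toC bt) (phase y).

(* xh k and yh k are the half-step iterates x^(k+1/2) and y^(k+1/2). *)
Record gps_iteration A (bt : 'cV[R]_m)
    (x lam xh : nat -> 'cV[C]_n) (y nu yh : nat -> 'cV[C]_m) : Prop := {
  gps_proj : forall k,
    is_orth_proj (graph A) (col_mx (x k - lam k) (y k - nu k))
                           (col_mx (xh k) (yh k));
  gps_x : forall k, x k.+1 = xh k + lam k;
  gps_y : forall k, y k.+1 = prox_f bt (yh k + nu k);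
  gps_lam : forall k, lam k.+1 = lam k + xh k - x k.+1;
  gps_nu : forall k, nu k.+1 = nu k + yh k - y k.+1 }.

Definition znat A xnat : 'cV[C]_(n + m) := col_mx xnat (A^t* *m xnat).

Definition ystar A b xnat theta : 'cV[C]_m :=
  hmul (toC (b + theta)) (phase (A^t* *m xnat)).

Definition zstar A b xnat (a : C) theta : 'cV[C]_(n + m) :=
  col_mx (a *: xnat) (a *: ystar A b xnat theta).

Definition F_param A b xnat (a : C) theta : Prop :=
  [/\ `|a| = 1,
      A *m hmul (toC theta) (phase (A^t* *m xnat)) = 0 &
      forall i, 0 <= b i 0 + theta i 0].

Definition Fset A b xnat : set 'cV[C]_(n + m) :=
  [set w | exists a theta, F_param A b xnat a theta /\
                           w = zstar A b xnat a theta].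

(* zstar A b xnat a theta is a nearest point of F to z. *)
Definition is_F_proj A b xnat (z : 'cV[C]_(n + m)) (a : C) theta : Prop :=
  F_param A b xnat a theta /\
  forall w, Fset A b xnat w ->
    enorm (zstar A b xnat a theta - z) <= enorm (w - z).

Definition Vball A b xnat (a : C) : set 'cV[C]_(n + m) :=
  [set z | enorm (z - a *: znat A xnat) < bmin b / 2].

Definition is_cholesky (M L : 'M[C]_n) : Prop :=
  [/\ is_trig_mx L, forall i, 0 < L i i & M = L *m L^t*].

Definition Cmx A (L : 'M[C]_n) : 'M[C]_(n, n + m) :=
  row_mx (invmx L) (invmx L *m A).

(* Omega has to be unitary, so a zero entry of xnat is given phase 1 instead of
   0 (with 0, B and v lose the corresponding coordinates of z, and a bound on
   J0 v does not control the iteration).  When xnat has no zero entry this is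
   diag (a * xnat / |xnat|).  The value chosen at zero entries does not affect
   the norm of v or of J0 v, as long as it has modulus 1. *)
Definition Omega_x xnat (a : C) : 'M[C]_n := diag_mx (a *: uphase xnat)^T.

Definition Omega_y A b xnat (a : C) theta : 'M[C]_m :=
  diag_mx (a *: phase (ystar A b xnat theta))^T.

Definition Omega A b xnat (a : C) theta : 'M[C]_(n + m) :=
  block_mx (Omega_x xnat a) 0 0 (Omega_y A b xnat a theta).

Definition Bmx A b xnat L (a : C) theta : 'M[C]_(n, n + m) :=
  Cmx A L *m Omega A b xnat a theta.

Definition vvec A b xnat (z : 'cV[C]_(n + m)) (a : C) theta : 'cV[C]_(n + m) :=
  col_mx ((Omega_x xnat a)^t* *m (usubmx z - a *: xnat))
         ((Omega_y A b xnat a theta)^t* *m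
            (dsubmx z - a *: ystar A b xnat theta)).

Definition iIm (q : 'cV[C]_m) : 'cV[C]_m := \col_i ('i * (complex.Im (q i 0))%:C).

Definition quot b theta : 'cV[R]_m := \col_i (b i 0 / (b i 0 + theta i 0)).

Definition Jk A b xnat L (a : C) theta (v : 'cV[C]_(n + m)) : 'cV[C]_(n + m) :=
  let B := Bmx A b xnat L a theta in
  (1%:M - B^t* *m B) *m v +
  (2%:R *: (B^t* *m B) - 1%:M) *m
    col_mx (usubmx v) (diag_mx (toC (quot b theta))^T *m iIm (dsubmx v)).

Definition J0 A b xnat L (a : C) theta (v : 'cV[C]_(n + m)) : 'cV[C]_(n + m) :=
  let B := Bmx A b xnat L a theta in
  (1%:M - B^t* *m B) *m v +
  (2%:R *: (B^t* *m B) - 1%:M) *m col_mx (usubmx v) (iIm (dsubmx v)).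

End PhaseRetrieval.

(* Main.v *)
Require Import Defs.
From HB Require Import structures.
From mathcomp Require Import all_boot all_order all_algebra.
From mathcomp Require Import complex.
From mathcomp Require Import boolp classical_sets reals.
From mathcomp Require Import ring lra.

Set Implicit Arguments.
Unset Strict Implicit.
Unset Printing Implicit Defensive.
Import Order.TTheory GRing.Theory Num.Theory.
Local Open Scope ring_scope.
Local Open Scope complex_scope.
Local Open Scope sesquilinear_scope.

(** After one step the multiplier lambda vanishes, so that x_k is the first
    block of z = zDR_k, and zDR follows the Douglas-Rachford map
      z |-> z - p + Pi (2 p - z),   p = (z_x, (b + noise) o z_y / |z_y|),
    with Pi the orthogonal projection onto the graph of A^* .  Since
    I + A A^* = L L^* , Pi = C^* C with C C^* = I.  Hence it is enough to bound
    e_k = |zDR_k - zs_k|, which dominates dist (x_k, xnat), and to do so it is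
    enough to bound the distance of zDR_(k+1) to the old point zs_k of F,
    because zs_(k+1) is a nearest one.

    In the coordinates v = Omega^* (z - zs_k), with P = B^* B, q the second
    block of v, s = b + theta and w = (s + q) / |s + q|, the new displacement is
    (I - P) v + (2 P - I) (v_x, (b + noise) w - b): the shift of the magnitudes
    by theta is invisible to Pi, because A (theta o y / |y|) = 0.  The
    reflection 2 P - I is an isometry, and applying it turns the displacement
    into P v + (0, (b + noise) w - b - q) (douglas_rachford_error).  The second
    block is the sum of four terms: - Re q, which gives J0; (b / s - 1) i Im q,
    which gives Jk - J0; the second order error of the phase, at most a constant
    times |v|^2; and noise o w, of norm at most |noise|.

    The announced rate beta + eps1 has no room for the quadratic error, while
    the two hypotheses on J0 and Jk - J0 only give the rate beta + eps1 for the
    linear part.  The point of the proof is that the linear part is in fact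
    faster, at rate beta + eps1 - c for some c > 0 that depends only on A, beta
    and eps1 (strict_rate_gap).  The triangle inequality for
    (P v - (0, Re q)) + (0, e), with e = (b / s - 1) i Im q, can be an equality
    only if the first summand has no x-component.  But P v lies in a rotated
    graph, where the x-component controls the whole vector, so then P v = 0 and
    |Re q| = beta |v| > 0; this makes |Im q| < |v|, and |e| <= eps1 |Im q| is
    not sharp.  For |v| small the quadratic error is absorbed by c |v|, hence
    e_(k+1) <= (beta + eps1) e_k + |noise|, and the claim follows by summing a
    geometric series, which also keeps e_k small. *)

(** * Euclidean geometry of complex column vectors *)

Section EuclideanNorm.
Variable R : realType.
Local Notation C := R[i].

Lemma cabs_sq (z : C) : cabs z ^+ 2 = complex.Re z ^+ 2 + complex.Im z ^+ 2.
Proof. by rewrite /cabs normc_def /= sqr_sqrtr // addr_ge0 // sqr_ge0. Qed.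

Lemma cabs_ge0 (z : C) : 0 <= cabs z.
Proof. by rewrite /cabs normc_def /= sqrtr_ge0. Qed.

Lemma normC_cabs (z : C) : `|z| = (cabs z)%:C.
Proof. by rewrite /cabs normc_def. Qed.

Lemma cabsM (z w : C) : cabs (z * w) = cabs z * cabs w.
Proof. by rewrite /cabs normrM !normc_def /= !mul0r subr0. Qed.

Lemma cabsr (c : R) : cabs c%:C = `|c|.
Proof. by rewrite /cabs normc_def /= expr0n /= addr0 sqrtr_sqr. Qed.

Lemma ReD (z w : C) : complex.Re (z + w) = complex.Re z + complex.Re w.
Proof. by case: z w => a b []. Qed.

(** The real inner product of the underlying real space: Jk and J0 are only
    real-linear. *)
Definition cdot p (u v : 'cV[C]_p) : R := complex.Re ((u^t* *m v) 0 0).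

Lemma trmxC_mul p q r (M : 'M[C]_(p, q)) (N : 'M[C]_(q, r)) :
  (M *m N)^t* = N^t* *m M^t*.
Proof. by rewrite trmx_mul map_mxM. Qed.

Lemma cdotE p (u v : 'cV[C]_p) : cdot u v =
  \sum_i (complex.Re (u i 0) * complex.Re (v i 0) +
          complex.Im (u i 0) * complex.Im (v i 0)).
Proof.
rewrite /cdot mxE (big_morph _ ReD (erefl _)).
apply: eq_bigr => i _; rewrite !mxE.
by case: (u i 0) (v i 0) => a b [c d] /=; ring.
Qed.

Lemma cdotC p (u v : 'cV[C]_p) : cdot u v = cdot v u.
Proof. by rewrite !cdotE; apply: eq_bigr => i _; ring. Qed.

Lemma cdotDr p (u v w : 'cV[C]_p) : cdot u (v + w) = cdot u v + cdot u w.
Proof. by rewrite /cdot mulmxDr mxE ReD. Qed.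

Lemma cdotDl p (u v w : 'cV[C]_p) : cdot (v + w) u = cdot v u + cdot w u.
Proof. by rewrite !(cdotC _ u) cdotDr. Qed.

Lemma cdotZr p (c : R) (u v : 'cV[C]_p) : cdot u (c%:C *: v) = c * cdot u v.
Proof.
rewrite !cdotE mulr_sumr; apply: eq_bigr => i _; rewrite !mxE.
by case: (u i 0) (v i 0) => a b [d e] /=; ring.
Qed.

Lemma cdotZl p (c : R) (u v : 'cV[C]_p) : cdot (c%:C *: u) v = c * cdot u v.
Proof. by rewrite cdotC cdotZr cdotC. Qed.

Lemma enorm_sq p (v : 'cV[C]_p) : enorm v ^+ 2 = cdot v v.
Proof.
rewrite /enorm sqr_sqrtr ?sumr_ge0 // => [|i _]; last exact: sqr_ge0.
by rewrite cdotE; apply: eq_bigr => i _; rewrite cabs_sq !expr2.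
Qed.

Lemma enorm_ge0 p (v : 'cV[C]_p) : 0 <= enorm v.
Proof. exact: sqrtr_ge0. Qed.

Lemma enorm_eq0 p (v : 'cV[C]_p) : enorm v = 0 -> v = 0.
Proof.
move=> v0; have := enorm_sq v; rewrite v0 cdotE expr0n /= => /esym/eqP.
rewrite psumr_eq0 => [/allP h|i _]; last by rewrite addr_ge0 // -expr2 sqr_ge0.
apply/matrixP => i j; rewrite (ord1 j) mxE.
have := h i (mem_index_enum i); rewrite /= -!expr2 paddr_eq0 ?sqr_ge0 //.
by rewrite !sqrf_eq0; case: (v i 0) => a b /= /andP[/eqP-> /eqP->].
Qed.

Lemma cauchy_schwarz p (u v : 'cV[C]_p) : cdot u v <= enorm u * enorm v.
Proof.
have [u0|un0] := eqVneq (enorm u) 0.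
  by rewrite u0 (enorm_eq0 u0) mul0r -(scale0r (0 : 'cV[C]_p)) cdotZl mul0r.
have [v0|vn0] := eqVneq (enorm v) 0.
  by rewrite v0 (enorm_eq0 v0) mulr0 -(scale0r (0 : 'cV[C]_p)) cdotZr mul0r.
have /= h := sqr_ge0 (enorm ((enorm v)%:C *: u + (- enorm u)%:C *: v)).
have uv_gt0 : 0 < enorm u * enorm v.
  by rewrite mulr_gt0 // lt_def ?un0 ?vn0 enorm_ge0.
move: h; rewrite enorm_sq !(cdotDl, cdotDr, cdotZl, cdotZr) -!enorm_sq.
rewrite (cdotC v u); nra.
Qed.

Lemma enormD p (u v : 'cV[C]_p) : enorm (u + v) <= enorm u + enorm v.
Proof.
rewrite -ler_sqr ?nnegrE ?addr_ge0 ?enorm_ge0 //.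
rewrite enorm_sq !(cdotDl, cdotDr) -!enorm_sq (cdotC v u) sqrrD.
have := cauchy_schwarz u v; lra.
Qed.

Lemma enorm_sqE p (v : 'cV[C]_p) : enorm v ^+ 2 = \sum_i cabs (v i 0) ^+ 2.
Proof. by rewrite /enorm sqr_sqrtr // sumr_ge0 // => i _; apply: sqr_ge0. Qed.

Lemma enorm_le_sq p q (u : 'cV[C]_p) (v : 'cV[C]_q) (K : R) : 0 <= K ->
  enorm u ^+ 2 <= K ^+ 2 * enorm v ^+ 2 -> enorm u <= K * enorm v.
Proof.
by move=> K0; rewrite -exprMn ler_sqr // nnegrE ?mulr_ge0 ?enorm_ge0.
Qed.

Lemma enormZ p (c : C) (v : 'cV[C]_p) : enorm (c *: v) = cabs c * enorm v.
Proof.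
apply/eqP; rewrite -(eqrXn2 (n := 2)) ?mulr_ge0 ?enorm_ge0 ?cabs_ge0 //.
rewrite exprMn !enorm_sqE mulr_sumr; apply/eqP/eq_bigr => i _.
by rewrite mxE cabsM exprMn.
Qed.

Lemma enormN p (v : 'cV[C]_p) : enorm (- v) = enorm v.
Proof. by rewrite -scaleN1r enormZ /cabs normrN1 /= mul1r. Qed.

Lemma enorm_distC p (u v : 'cV[C]_p) : enorm (u - v) = enorm (v - u).
Proof. by rewrite -enormN opprB. Qed.

Lemma enorm_isometry p q (M : 'M[C]_(p, q)) (v : 'cV[C]_q) :
  M^t* *m M = 1%:M -> enorm (M *m v) = enorm v.
Proof.
move=> MM; apply/eqP; rewrite -(eqrXn2 (n := 2)) ?enorm_ge0 // !enorm_sq.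
by rewrite /cdot trmxC_mul -mulmxA (mulmxA _ M) MM mul1mx.
Qed.

Lemma enorm_col_mx p q (u : 'cV[C]_p) (v : 'cV[C]_q) :
  enorm (col_mx u v) ^+ 2 = enorm u ^+ 2 + enorm v ^+ 2.
Proof.
rewrite !enorm_sqE big_split_ord /=; congr (_ + _).
  by apply: eq_bigr => i _; rewrite col_mxEu.
by apply: eq_bigr => i _; rewrite col_mxEd.
Qed.

Lemma cabs_le_enorm p (v : 'cV[C]_p) i : cabs (v i 0) <= enorm v.
Proof.
rewrite -ler_sqr ?nnegrE ?cabs_ge0 ?enorm_ge0 // enorm_sqE (bigD1 i) //=.
by rewrite lerDl sumr_ge0 // => j _; apply: sqr_ge0.
Qed.

Lemma enorm_sum p (I : finType) (F : I -> 'cV[C]_p) :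
  enorm (\sum_i F i) <= \sum_i enorm (F i).
Proof.
apply: (big_ind2 (fun u c => enorm u <= c)) => // [|u a v c ua vc].
  by rewrite -(scale0r (0 : 'cV[C]_p)) enormZ cabsr normr0 mul0r.
by rewrite (le_trans (enormD _ _)) // lerD.
Qed.

Lemma enorm_mulmx_bounded p q (M : 'M[C]_(p, q)) :
  exists2 K, 0 <= K & forall v, enorm (M *m v) <= K * enorm v.
Proof.
exists (\sum_j enorm (col j M)) => [|v].
  by rewrite sumr_ge0 // => j _; apply: enorm_ge0.
have -> : M *m v = \sum_j v j 0 *: col j M.
  apply/matrixP => i k; rewrite (ord1 k) !mxE summxE.
  by apply: eq_bigr => j _; rewrite !mxE mulrC.
rewrite (le_trans (enorm_sum _)) // mulr_suml ler_sum // => j _.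
by rewrite enormZ mulrC ler_wpM2l ?enorm_ge0 // cabs_le_enorm.
Qed.

(** The supremum in [opnorm] is an upper bound only of a set that is bounded
    above, which is what K provides. *)
Lemma enorm_homogeneous_opnorm p q (T : 'cV[C]_p -> 'cV[C]_q) (K : R) :
  0 <= K -> (forall v, enorm (T v) <= K * enorm v) ->
  (forall (c : R) v, T (c%:C *: v) = c%:C *: T v) ->
  forall v, enorm (T v) <= opnorm T * enorm v.
Proof.
move=> K0 TK Tc v.
have [v0|vn0] := eqVneq (enorm v) 0.
  by rewrite (le_trans (TK v)) // v0 !mulr0.
have v_gt0 : 0 < enorm v by rewrite lt_def vn0 enorm_ge0.
rewrite -ler_pdivrMr // mulrC.
have -> : (enorm v)^-1 * enorm (T v) = enorm (T ((enorm v)^-1%:C *: v)).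
  by rewrite Tc enormZ cabsr gtr0_norm // invr_gt0.
apply: ub_le_sup.
  exists K => _ [u u1 <-]; rewrite (le_trans (TK u)) // ler_piMr //.
exists ((enorm v)^-1%:C *: v) => //=.
by rewrite enormZ cabsr gtr0_norm ?invr_gt0 // mulVf.
Qed.

End EuclideanNorm.

(** * Scalar estimates *)

(** The numbers are the norms in the linear part of one step: V of v, U and W of
    the imaginary and real parts of q, a of P v - (0, Re q), ax and ay of the
    blocks of that vector, e of (b / s - 1) i Im q, and X of their sum
    P v + (0, - Re q + (b / s - 1) i Im q). *)
Definition rate_gap (R : realType) (beta eps kappa c : R) : Prop :=
  forall V U W a ax ay e X : R,
    0 <= V -> 0 <= U -> 0 <= W -> 0 <= a -> 0 <= ax -> 0 <= ay -> 0 <= e ->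
    0 <= X ->
    a ^+ 2 = ax ^+ 2 + ay ^+ 2 -> a <= beta * V -> e <= eps * U ->
    U ^+ 2 + W ^+ 2 <= V ^+ 2 -> a <= kappa * ax + W ->
    X <= a + e -> X ^+ 2 <= ax ^+ 2 + (ay + e) ^+ 2 ->
    X <= (beta + eps - c) * V.

(** Equality X = (beta + eps) V would need W = 0, ax = 0 and a = beta V at once,
    against a <= kappa ax + W.  A quantitative form needs three cases: W is not
    small, and e loses; W and ax are small, and a loses; ax is not small, and
    the triangle inequality X <= a + e loses, because e is orthogonal to the
    x-block. *)
Lemma strict_rate_gap (R : realType) (beta eps kappa : R) :
  0 < beta -> 0 < eps -> 1 <= kappa ->
  exists2 c, 0 < c & rate_gap beta eps kappa c.
Proof.
move=> b0 e0 k1; have k0 : 0 < kappa by lra.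
set eta := beta / 4; have eta0 : 0 < eta by rewrite /eta; lra.
set gam := eta / kappa.
have gam0 : 0 < gam by rewrite divr_gt0.
have gamk : kappa * gam = eta by rewrite /gam mulrC divfK // gt_eqF.
have gam_eta : gam <= eta by rewrite -gamk; nra.
set rho := beta + eps; have rho0 : 0 < rho by rewrite /rho; lra.
set d := gam ^+ 2 / (2 * beta).
have d0 : 0 < d by rewrite divr_gt0 ?exprn_gt0 //; lra.
have dE : 2 * beta * d = gam ^+ 2 by rewrite /d mulrC divfK // gt_eqF //; lra.
have dbeta : d <= beta by rewrite /eta in gam_eta; nra.
set c3 := eps * d / rho; have c30 : 0 < c3 by rewrite divr_gt0 // mulr_gt0.
have c3E : c3 * rho = eps * d by rewrite /c3 divfK // gt_eqF.
have c3rho : c3 <= rho by rewrite /rho in c3E *; nra.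
(* [z] makes 1 - z nonnegative with 1 - eta^2 <= (1 - z)^2. *)
have [z z0 [z1 z2]] : exists2 z, 0 < z & z <= 1 /\ 2 * z <= eta ^+ 2.
  have ee : 0 < eta ^+ 2 by rewrite exprn_gt0.
  by case: (lerP (eta ^+ 2 / 2) 1) => h; [exists (eta ^+ 2 / 2) | exists 1];
    try (split); lra.
exists (Num.min (eps * z) (Num.min (beta / 2) c3)).
  by rewrite !lt_min c30 mulr_gt0 //= andbT; lra.
move=> V U W a t n e X V0 U0 W0 a0 t0 n0 e_ge0 X0 aE aV eU UW ak Xae X2.
set c := Num.min _ _.
have c_1 : c <= eps * z by rewrite ge_min lexx.
have c_2 : c <= beta / 2 by rewrite ge_min ge_min lexx orbT.
have c_3 : c <= c3 by rewrite ge_min ge_min lexx !orbT.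
have weaken c' : c <= c' -> X <= (rho - c') * V -> X <= (rho - c) * V.
  move=> cc' h; apply: (le_trans h); rewrite ler_wpM2r //; lra.
have [Wbig|Wsmall] := lerP (eta * V) W.
  apply: (weaken _ c_1).
  have hU : U <= (1 - z) * V.
    rewrite -ler_sqr ?nnegrE ?mulr_ge0 //; last by lra.
    have hW : eta ^+ 2 * V ^+ 2 <= W ^+ 2.
      by rewrite -exprMn ler_sqr ?nnegrE // mulr_ge0 // ltW.
    have hV : 2 * z * V ^+ 2 <= eta ^+ 2 * V ^+ 2 by rewrite ler_wpM2r ?sqr_ge0.
    rewrite exprMn; nra.
  rewrite /rho; nra.
(* gam = eta / kappa and eta = beta / 4 give kappa t + W <= beta V / 2. *)
have [tsmall|tbig] := ltrP t (gam * V).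
  apply: (weaken _ c_2).
  have : kappa * t <= eta * V.
    by rewrite -gamk -mulrA ler_wpM2l // ltW.
  have : U <= V by rewrite -ler_sqr ?nnegrE //; nra.
  rewrite /rho /eta in Wsmall *; nra.
apply: (weaken _ c_3).
have t2 : 2 * beta * d * V ^+ 2 <= t ^+ 2.
  by rewrite dE -exprMn ler_sqr ?nnegrE // mulr_ge0 // ltW.
have a2 : a ^+ 2 <= beta ^+ 2 * V ^+ 2.
  by rewrite -exprMn ler_sqr ?nnegrE // mulr_ge0 // ltW.
have nle : n <= (beta - d) * V.
  rewrite -ler_sqr ?nnegrE ?mulr_ge0 //; last by lra.
  rewrite exprMn; nra.
have eV : e <= eps * V.
  have : U <= V by rewrite -ler_sqr ?nnegrE //; nra.
  nra.
have ne : n * e <= (beta - d) * V * (eps * V) by rewrite ler_pM.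
have e2 : e ^+ 2 <= eps ^+ 2 * V ^+ 2.
  by rewrite -exprMn ler_sqr ?nnegrE // mulr_ge0 // ltW.
rewrite -ler_sqr ?nnegrE ?mulr_ge0 //; last by lra.
have -> : ((rho - c3) * V) ^+ 2 =
          (rho ^+ 2 - 2 * (c3 * rho) + c3 ^+ 2) * V ^+ 2.
  by ring.
rewrite c3E; have c3V := sqr_ge0 (c3 * V); rewrite exprMn in c3V.
apply: (@le_trans _ _ ((rho ^+ 2 - 2 * (eps * d)) * V ^+ 2)); last by nra.
rewrite /rho; nra.
Qed.

(** The derivative at s > 0 of the phase in the direction q is i Im q / s: a
    positive number keeps its phase under a real perturbation. *)
Lemma phase_second_order (R : realType) (s : R) (q : R[i]) :
  0 < s -> cabs q <= s / 2 ->
  s / 2 <= cabs (s%:C + q) /\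
  cabs ((s%:C + q) / `|s%:C + q| - 1 - 'i * (complex.Im q / s)%:C)
    <= 3 / s ^+ 2 * cabs q ^+ 2.
Proof.
move=> s0 qs.
have q2 := cabs_sq q; have q0 := cabs_ge0 q.
case: q qs q2 q0 => x y; set Q := cabs _; move=> /= qs q2 q0.
set w := s%:C + _; have wE : w = Complex (s + x) y.
  by apply/eqP; rewrite /w eq_complex /= add0r !eqxx.
have w2 := cabs_sq w; rewrite {2 3}wE /= in w2.
rewrite normC_cabs; have r0 := cabs_ge0 w; set r := cabs w in r0 w2 *.
have xQ : - Q <= x <= Q.
  by rewrite -ler_norml -ler_sqr ?nnegrE // real_normK ?num_real // q2; nra.
have rs : s / 2 <= r.
  rewrite -ler_sqr ?nnegrE //; last by lra.
  rewrite w2; nra.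
have rgt0 : 0 < r by lra.
split=> //.
rewrite -ler_sqr ?nnegrE ?cabs_ge0 ?mulr_ge0 ?sqr_ge0 ?invr_ge0 ?sqr_ge0 //.
rewrite cabs_sq.
have -> : w / r%:C - 1 - 'i%C * (y / s)%:C =
          Complex ((s + x) / r - 1) (y / r - y / s).
  rewrite wE; apply/eqP; rewrite eq_complex /=.
  apply/andP; split; apply/eqP; field; try (by rewrite !gt_eqF).
rewrite /=.
set h := Q ^+ 2 / s ^+ 2.
have hE : h * s ^+ 2 = Q ^+ 2 by rewrite /h divfK // sqrf_eq0 gt_eqF.
have h0 : 0 <= h by rewrite divr_ge0 ?sqr_ge0.
have hh0 : 0 <= 2 * h by lra.
have y2 : y ^+ 2 <= Q ^+ 2 by rewrite q2 lerDr sqr_ge0.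
have re : ((s + x) / r - 1) ^+ 2 <= (2 * h) ^+ 2.
  set t := r - (s + x); have -> : (s + x) / r - 1 = - (t / r).
    by rewrite /t; field; rewrite gt_eqF.
  have t0 : 0 <= t.
    by rewrite subr_ge0 -ler_sqr ?nnegrE //; [rewrite w2 lerDl sqr_ge0 | lra].
  have tE : t * (r + (s + x)) = y ^+ 2.
    by rewrite /t -subr_sqr w2; ring.
  have ts : t <= h * s.
    rewrite -(ler_pM2r s0) -mulrA -expr2 hE (le_trans _ y2) // -tE.
    by rewrite ler_wpM2l //; lra.
  rewrite sqrrN ler_sqr ?nnegrE ?(divr_ge0 t0 r0) // ler_pdivrMr //.
  by rewrite (le_trans ts) //; nra.
have im : (y / r - y / s) ^+ 2 <= (2 * h) ^+ 2.
  have -> : y / r - y / s = y * (s - r) / (r * s).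
    by field; rewrite !gt_eqF.
  rewrite expr_div_n ler_pdivrMr ?exprn_gt0 ?mulr_gt0 //.
  have sr2 : (s - r) ^+ 2 <= Q ^+ 2.
    have sQx : 0 <= s * (Q + x) by rewrite mulr_ge0 ?(ltW s0) //; lra.
    have sQx' : 0 <= s * (Q - x) by rewrite mulr_ge0 ?(ltW s0) //; lra.
    have rle : r <= s + Q.
      by rewrite -ler_sqr ?nnegrE //; [rewrite w2; nra | lra].
    have rge : s - Q <= r.
      by rewrite -ler_sqr ?nnegrE //; [rewrite w2; nra | lra].
    by rewrite -[(s - r) ^+ 2]real_normK ?num_real // ler_sqr ?nnegrE //
      ler_norml; apply/andP; split; lra.
  rewrite exprMn (le_trans (ler_pM (sqr_ge0 _) (sqr_ge0 _) y2 sr2)) //.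
  rewrite -hE -!exprMn.
  have -> : (h * s ^+ 2) * (h * s ^+ 2) = (h * s * s) ^+ 2 by ring.
  have hs0 : 0 <= h * s by rewrite mulr_ge0 // ltW.
  have rs0 : 0 <= r * s by rewrite mulr_ge0 // ltW.
  have hs : 0 <= h * s * (2 * r - s) by rewrite mulr_ge0 //; lra.
  rewrite ler_sqr ?nnegrE ?(mulr_ge0 hs0 (ltW s0)) ?(mulr_ge0 hh0 rs0) //.
  lra.
rewrite (_ : 3 / s ^+ 2 * Q ^+ 2 = 3 * h); last by rewrite /h; ring.
have h20 := sqr_ge0 h.
have -> : (3 * h) ^+ 2 = 9 * h ^+ 2 by ring.
have e4 : (2 * h) ^+ 2 = 4 * h ^+ 2 by ring.
rewrite e4 in re im. lra.
Qed.

(** * The projection onto the graph and its reflection *)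

Section Reflection.
Variables (R : realType) (p : nat) (P : 'M[R[i]]_p).
Hypotheses (PH : P^t* = P) (PP : P *m P = P).

Let N := 2%:R *: P - 1%:M.

Lemma reflection_fixes_range : N *m P = P.
Proof. by rewrite /N mulmxBl mul1mx -scalemxAl PP scaler_nat mulr2n addrK. Qed.

Lemma reflection_involutive : N *m N = 1%:M.
Proof.
rewrite {2}/N mulmxBr mulmx1 -scalemxAr reflection_fixes_range.
by rewrite /N opprB addrC subrK.
Qed.

Lemma trmxC_reflection : N^t* = N.
Proof.
rewrite /N -[in RHS]PH; apply/matrixP => i j; rewrite !mxE.
by rewrite rmorphB rmorphM /= rmorph_nat rmorph_nat eq_sym.
Qed.

Lemma enorm_reflection v : enorm (N *m v) = enorm v.
Proof. by rewrite enorm_isometry // trmxC_reflection reflection_involutive. Qed.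

(** The reflection N is an isometric involution that fixes the range of P and
    changes the sign of its orthogonal complement, so N (I - P) = P - I. *)
Lemma enorm_split_reflection v g :
  enorm ((1%:M - P) *m v + N *m g) = enorm (P *m v + (g - v)).
Proof.
rewrite -enorm_reflection mulmxDr !mulmxA reflection_involutive mul1mx.
have -> : N *m (1%:M - P) = P - 1%:M.
  rewrite mulmxBr mulmx1 reflection_fixes_range /N scaler_nat mulr2n.
  by rewrite addrAC addrK.
by rewrite mulmxBl mul1mx -addrA (addrC (- v)).
Qed.
End Reflection.

Section GraphProjection.
Variables (R : realType) (n m : nat) (A : 'M[R[i]]_(n, m)) (L : 'M[R[i]]_n).
Hypothesis hL : is_cholesky (1%:M + A *m A^t*) L.
Local Notation C := (Cmx A L).

Lemma cholesky_unitmx : L \in unitmx.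
Proof.
case: hL => trigL Lgt0 _; rewrite unitmxE det_trig // unitfE.
by apply/prodf_neq0 => i _; rewrite gt_eqF.
Qed.

Lemma trmxC1 k : (1%:M : 'M[R[i]]_k)^t* = 1%:M.
Proof. by rewrite trmx1 map_mx1. Qed.

(** The range is the graph, and multiplication by the inverse of L^* on the
    right makes the columns orthonormal: this is C^* ([Cmx_trmxC]). *)
Definition graph_mx : 'M[R[i]]_(n + m, n) := col_mx 1%:M (A^t*).

Lemma graph_mxP x : graph A (graph_mx *m x).
Proof. by rewrite /graph/= mul_col_mx col_mxKu col_mxKd mul1mx. Qed.

Lemma graphE z : graph A z -> z = graph_mx *m usubmx z.
Proof. by move=> zA; rewrite mul_col_mx mul1mx zA vsubmxK. Qed.

Lemma Cmx_trmxC : C^t* = graph_mx *m (invmx L)^t*.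
Proof.
have -> : C = invmx L *m graph_mx^t*.
  by rewrite /graph_mx tr_col_mx map_row_mx trmxCK trmxC1 mul_mx_row mulmx1.
by rewrite trmxC_mul trmxCK.
Qed.

Lemma trmxC_invL : L^t* *m (invmx L)^t* = 1%:M.
Proof. by rewrite -trmxC_mul mulVmx ?cholesky_unitmx // trmxC1. Qed.

Lemma Cmx_graph_mx : C *m graph_mx = L^t*.
Proof.
rewrite mul_row_col mulmx1 -mulmxA -[X in X + _]mulmx1 -mulmxDr.
by case: hL => _ _ ->; rewrite mulKmx // cholesky_unitmx.
Qed.

Lemma Cmx_coisometry : C *m C^t* = 1%:M.
Proof. by rewrite Cmx_trmxC mulmxA Cmx_graph_mx trmxC_invL. Qed.

Lemma Cmx_proj_graph z : graph A z -> C^t* *m (C *m z) = z.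
Proof.
move=> /graphE ->; rewrite (mulmxA C) Cmx_graph_mx Cmx_trmxC -mulmxA.
by rewrite (mulmxA ((invmx L)^t*)) (mulmx1C trmxC_invL) mul1mx.
Qed.

(** The residual z - w is orthogonal to the range of [graph_mx], hence killed by
    C, and C^* C is the identity on the graph. *)
Lemma orth_proj_graphE z w :
  is_orth_proj (graph A) z w -> w = C^t* *m (C *m z).
Proof.
case=> gw orth; have Czw : graph_mx^t* *m (z - w) = 0.
  apply: enorm_eq0; apply/eqP; rewrite -sqrf_eq0 enorm_sq.
  set x := _ *m (z - w).
  have := orth _ (graph_mxP x); rewrite trmxC_mul -mulmxA -/x.
  by rewrite /cdot => ->; rewrite mxE.
rewrite -{1}(Cmx_proj_graph gw); congr (_ *m _).
apply/eqP; rewrite eq_sym -subr_eq0 -mulmxBr.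
by rewrite -[C]trmxCK Cmx_trmxC trmxC_mul -mulmxA Czw mulmx0.
Qed.

End GraphProjection.

(** * The rotation to the phases of the solution *)

Section Phases.
Variable R : realType.

Lemma diag_mx_isometry p (d : 'cV[R[i]]_p) : (forall i, `|d i 0| = 1) ->
  (diag_mx d^T)^t* *m diag_mx d^T = 1%:M.
Proof.
move=> d1; rewrite tr_diag_mx map_diag_mx mulmx_diag -diag_const_mx.
congr diag_mx; apply/matrixP => i j; rewrite (ord1 i) !mxE.
by rewrite mulrC -normCK d1 expr1n.
Qed.

Lemma mul_diag_hmul p (d v : 'cV[R[i]]_p) : diag_mx d^T *m v = hmul d v.
Proof.
apply/matrixP => i j; rewrite (ord1 j) mxE (bigD1 i) //= !mxE eqxx mulr1n.
by rewrite big1 ?addr0 // => k ki; rewrite !mxE eq_sym (negbTE ki) mul0r.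
Qed.

Lemma norm_phase (z : R[i]) : z != 0 -> `|z / `|z| | = 1.
Proof. by move=> z0; rewrite normrM normfV normr_id mulfV // normr_eq0. Qed.

Lemma phase_mul_unimodular (c z : R[i]) : `|c| = 1 ->
  (c * z) / `|c * z| = c * (z / `|z|).
Proof. by move=> c1; rewrite normrM c1 mul1r mulrA. Qed.

Lemma phase_scale_pos (s : R) (z : R[i]) : 0 < s ->
  (s%:C * z) / `|s%:C * z| = z / `|z|.
Proof.
move=> s0.
have sC0 : s%:C != 0 :> R[i] by rewrite eq_complex /= negb_and gt_eqF.
have -> : `|s%:C * z| = s%:C * `|z|.
  by rewrite normrM; congr (_ * _); rewrite normC_cabs cabsr gtr0_norm.
by rewrite -mulf_div divff // mul1r.
Qed.

Lemma norm_uphase p (v : 'cV[R[i]]_p) i : `|uphase v i 0| = 1.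
Proof. by rewrite mxE; case: eqVneq => [_|/norm_phase //]; rewrite normr1. Qed.
End Phases.

Section Rotation.
Variables (R : realType) (n m : nat) (A : 'M[R[i]]_(n, m)) (b : 'cV[R]_m).
Variables (xnat : 'cV[R[i]]_n) (a : R[i]) (theta : 'cV[R]_m).
Hypothesis xnat_sol : phase_retrieval_sol A b xnat.
Hypothesis b_gt0 : forall i, 0 < b i 0.
Hypothesis a1 : `|a| = 1.
Hypothesis s_gt0 : forall i, 0 < b i 0 + theta i 0.

Local Notation u := (phase (A^t* *m xnat)).
Local Notation Om := (Omega A b xnat a theta).

Lemma ynat_neq0 i : (A^t* *m xnat) i 0 != 0.
Proof.
apply/eqP => y0; have := xnat_sol i; rewrite y0 => /esym b0.
by have := b_gt0 i; rewrite b0 /cabs normr0 ltxx.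
Qed.

Lemma norm_phase_ynat i : `|u i 0| = 1.
Proof. by rewrite mxE norm_phase // ynat_neq0. Qed.

Lemma ynatE : A^t* *m xnat = hmul (toC b) u.
Proof.
apply/matrixP => i j; rewrite (ord1 j) [RHS]mxE [in toC b _ _]mxE.
rewrite [u i 0]mxE -[b i 0](xnat_sol i) -normC_cabs mulrC divfK //.
by rewrite normr_eq0 ynat_neq0.
Qed.

(** Positive magnitudes do not change phases, so that [Omega_y] does not depend
    on theta. *)
Lemma phase_ystar : phase (ystar A b xnat theta) = u.
Proof.
apply/matrixP => i j; rewrite (ord1 j) [LHS]mxE [ystar _ _ _ _ i 0]mxE.
rewrite [toC _ i 0]mxE [(b + theta) i 0]mxE phase_scale_pos //.
by rewrite norm_phase_ynat divr1.
Qed.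

Lemma Omega_yE : Omega_y A b xnat a theta = diag_mx (a *: u)^T.
Proof. by rewrite /Omega_y phase_ystar. Qed.

Lemma Omega_x_isometry : (Omega_x xnat a)^t* *m Omega_x xnat a = 1%:M.
Proof.
by apply: diag_mx_isometry => i; rewrite mxE normrM a1 norm_uphase mul1r.
Qed.

Lemma Omega_y_isometry :
  (Omega_y A b xnat a theta)^t* *m Omega_y A b xnat a theta = 1%:M.
Proof.
rewrite Omega_yE; apply: diag_mx_isometry => i.
by rewrite mxE normrM a1 norm_phase_ynat mul1r.
Qed.

Lemma trmxC_Omega : Om^t* =
  block_mx ((Omega_x xnat a)^t*) 0 0 ((Omega_y A b xnat a theta)^t*).
Proof. by rewrite /Om tr_block_mx map_block_mx !trmx0 !map_mx0. Qed.

Lemma Omega_isometry : Om^t* *m Om = 1%:M.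
Proof.
rewrite trmxC_Omega mulmx_block !mul0mx !mulmx0 !add0r addr0.
by rewrite Omega_x_isometry Omega_y_isometry scalar_mx_block.
Qed.

(** Omega is unitary, so v is the displacement z - zs in other coordinates. *)
Lemma Omega_vvec z : Om *m vvec A b xnat z a theta = z - zstar A b xnat a theta.
Proof.
rewrite mul_block_col !mul0mx addr0 add0r !mulmxA.
rewrite (mulmx1C Omega_x_isometry) (mulmx1C Omega_y_isometry) !mul1mx.
by rewrite -[in RHS](vsubmxK z) /zstar opp_col_mx add_col_mx.
Qed.

Lemma enorm_vvec z :
  enorm (vvec A b xnat z a theta) = enorm (z - zstar A b xnat a theta).
Proof. by rewrite -Omega_vvec enorm_isometry // Omega_isometry. Qed.

(** The phases factor out of the second block of z, and leave a perturbation of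
    the positive vector s = b + theta. *)
Lemma dsubmx_Omega z i : dsubmx z i 0 =
  a * u i 0 * ((b i 0 + theta i 0)%:C + dsubmx (vvec A b xnat z a theta) i 0).
Proof.
have := Omega_vvec z; move: (vvec _ _ _ _ _ _) => v.
rewrite -{1}(vsubmxK v) mul_block_col !mul0mx add0r.
move=> /(congr1 (fun w : 'cV_(n + m) => dsubmx w i 0)).
rewrite col_mxKd linearB /= /zstar col_mxKd Omega_yE mul_diag_hmul.
rewrite [hmul (a *: u) _ i 0]mxE [(a *: u) i 0]mxE.
rewrite [fun_of_matrix (_ - _) i 0]mxE [fun_of_matrix (- _) i 0]mxE.
rewrite [(a *: ystar _ _ _ _) i 0]mxE [ystar _ _ _ _ i 0]mxE.
rewrite [toC _ i 0]mxE [(b + theta) i 0]mxE => /esym/(canRL (subrK _)) ->.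
by move: (u i 0) (dsubmx v i 0) (_%:C) => U V W; ring.
Qed.

End Rotation.

(** * One Douglas-Rachford step in rotated coordinates *)

Section RealImaginary.
Variable R : realType.

Definition re_part p (q : 'cV[R[i]]_p) : 'cV[R[i]]_p :=
  \col_i (complex.Re (q i 0))%:C.

Lemma re_iIm p (q : 'cV[R[i]]_p) : q = re_part q + iIm q.
Proof.
apply/matrixP => i j; rewrite (ord1 j) !mxE.
by case: (q i 0) => x y; apply/eqP; rewrite eq_complex /=; apply/andP; split;
  apply/eqP; ring.
Qed.

Lemma enorm_re_iIm p (q : 'cV[R[i]]_p) :
  enorm q ^+ 2 = enorm (re_part q) ^+ 2 + enorm (iIm q) ^+ 2.
Proof.
rewrite !enorm_sqE -big_split /=; apply: eq_bigr => i _; rewrite !cabs_sq !mxE.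
by case: (q i 0) => x y /=; ring.
Qed.

Lemma iIm_idem p (q : 'cV[R[i]]_p) : iIm (iIm q) = iIm q.
Proof.
apply/matrixP => i j; rewrite !mxE; case: (q i 0) => x y.
by apply/eqP; rewrite eq_complex /=; apply/andP; split; apply/eqP; ring.
Qed.

Lemma iImZ p (c : R) (q : 'cV[R[i]]_p) : iIm (c%:C *: q) = c%:C *: iIm q.
Proof.
apply/matrixP => i j; rewrite !mxE; case: (q i 0) => x y.
by apply/eqP; rewrite eq_complex /=; apply/andP; split; apply/eqP; ring.
Qed.

Lemma enorm_iIm_le p (q : 'cV[R[i]]_p) : enorm (iIm q) <= enorm q.
Proof.
by rewrite -ler_sqr ?nnegrE ?enorm_ge0 // [leRHS]enorm_re_iIm lerDr sqr_ge0.
Qed.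

Lemma enorm_col0 p q (v : 'cV[R[i]]_q) : enorm (col_mx (0 : 'cV_p) v) = enorm v.
Proof.
apply/eqP; rewrite -(eqrXn2 (n := 2)) ?enorm_ge0 // enorm_col_mx.
have -> : enorm (0 : 'cV[R[i]]_p) = 0.
  by rewrite -(scale0r (0 : 'cV[R[i]]_p)) enormZ cabsr normr0 mul0r.
by rewrite expr0n add0r.
Qed.

Lemma enorm_dsubmx_le p q (v : 'cV[R[i]]_(p + q)) : enorm (dsubmx v) <= enorm v.
Proof.
rewrite -ler_sqr ?nnegrE ?enorm_ge0 // -[in leRHS](vsubmxK v) enorm_col_mx.
by rewrite lerDr sqr_ge0.
Qed.

Lemma enorm_usubmx_le p q (v : 'cV[R[i]]_(p + q)) : enorm (usubmx v) <= enorm v.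
Proof.
rewrite -ler_sqr ?nnegrE ?enorm_ge0 // -[in leRHS](vsubmxK v) enorm_col_mx.
by rewrite lerDl sqr_ge0.
Qed.
End RealImaginary.

Definition douglas_rachford (R : realType) n m (A : 'M[R[i]]_(n, m)) L
    (bt : 'cV[R]_m) (z : 'cV[R[i]]_(n + m)) : 'cV[R[i]]_(n + m) :=
  let p := col_mx (usubmx z) (prox_f bt (dsubmx z)) in
  z - p + (Cmx A L)^t* *m (Cmx A L *m (2%:R *: p - z)).

Section OneStep.
Variables (R : realType) (n m : nat) (A : 'M[R[i]]_(n, m)) (b : 'cV[R]_m).
Variables (xnat : 'cV[R[i]]_n) (L : 'M[R[i]]_n) (a : R[i]) (theta : 'cV[R]_m).
Hypothesis hL : is_cholesky (1%:M + A *m A^t*) L.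
Hypothesis xnat_sol : phase_retrieval_sol A b xnat.
Hypothesis b_gt0 : forall i, 0 < b i 0.
Hypothesis a1 : `|a| = 1.
Hypothesis s_gt0 : forall i, 0 < b i 0 + theta i 0.

Local Notation u := (phase (A^t* *m xnat)).
Local Notation Om := (Omega A b xnat a theta).
Local Notation C := (Cmx A L).
Local Notation B := (Bmx A b xnat L a theta).
Local Notation P := (B^t* *m B).
Local Notation J0 := (J0 A b xnat L a theta).
Local Notation Jk := (Jk A b xnat L a theta).

Lemma Omega_unitary : Om *m Om^t* = 1%:M.
Proof. exact/mulmx1C/Omega_isometry. Qed.

Lemma Bmx_coisometry : B *m B^t* = 1%:M.
Proof.
rewrite /Bmx trmxC_mul mulmxA -(mulmxA C) Omega_unitary mulmx1.
exact: Cmx_coisometry.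
Qed.

Lemma proj_herm : P^t* = P.
Proof. by rewrite trmxC_mul trmxCK. Qed.

Lemma proj_idem : P *m P = P.
Proof. by rewrite mulmxA -(mulmxA _ B) Bmx_coisometry mulmx1. Qed.

Lemma enorm_J0 v :
  enorm (J0 v) = enorm (P *m v - col_mx 0 (re_part (dsubmx v))).
Proof.
rewrite /Defs.J0 enorm_split_reflection ?proj_herm ?proj_idem //.
congr (enorm (_ + _)); rewrite -[X in _ - X](vsubmxK v) opp_col_mx add_col_mx.
rewrite [X in col_mx _ (_ - X)]re_iIm subrr opprD addrCA subrr addr0.
by rewrite opp_col_mx oppr0.
Qed.

(** The entries b / s - 1 of the real diagonal matrix in Jk - J0. *)
Definition quot_shift : 'cV[R[i]]_m := \col_i (quot b theta i 0 - 1)%:C.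

Lemma Jk_sub_J0 v : Jk v - J0 v =
  (2%:R *: P - 1%:M) *m col_mx 0 (hmul quot_shift (iIm (dsubmx v))).
Proof.
rewrite /Defs.Jk /Defs.J0 opprD addrACA subrr add0r -mulmxBr.
rewrite opp_col_mx add_col_mx subrr.
congr (_ *m col_mx _ _); rewrite mul_diag_hmul; apply/matrixP => i j.
rewrite (ord1 j) [in LHS]mxE [hmul quot_shift _ i 0]mxE [quot_shift i 0]mxE.
rewrite [hmul _ _ i 0]mxE [toC _ i 0]mxE [fun_of_matrix (- _) i 0]mxE.
by rewrite rmorphB rmorph1 /= mulrBl mul1r.
Qed.

Lemma enorm_Jk_sub_J0 v :
  enorm (Jk v - J0 v) = enorm (hmul quot_shift (iIm (dsubmx v))).
Proof.
by rewrite Jk_sub_J0 enorm_reflection ?proj_herm ?proj_idem // enorm_col0.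
Qed.

(** Jk - J0 sees only i Im of the second block, and [iIm] is idempotent: on
    (0, i Im q) the bound by the operator norm does not waste the norm of the
    other components of v. *)
Lemma quot_shift_opnorm q : enorm (hmul quot_shift (iIm q)) <=
  opnorm (fun v => Jk v - J0 v) * enorm (iIm q).
Proof.
have [K K0 DK] := enorm_mulmx_bounded (diag_mx quot_shift^T).
set T := fun v => Jk v - J0 v.
have Tnorm v : enorm (T v) = enorm (hmul quot_shift (iIm (dsubmx v))).
  exact: enorm_Jk_sub_J0.
have [N TE] : exists N : 'M_(n + m), forall v,
    T v = N *m col_mx 0 (hmul quot_shift (iIm (dsubmx v))).
  by exists (2%:R *: P - 1%:M); exact: Jk_sub_J0.
have T_bounded v : enorm (T v) <= K * enorm v.
  rewrite Tnorm -mul_diag_hmul (le_trans (DK _)) // ler_wpM2l //.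
  exact: le_trans (enorm_iIm_le _) (enorm_dsubmx_le _).
have T_homogeneous (c : R) v : T (c%:C *: v) = c%:C *: T v.
  have dsubZ : dsubmx (c%:C *: v) = c%:C *: dsubmx v by rewrite linearZ.
  rewrite !TE dsubZ iImZ -!mul_diag_hmul -(scalemxAr _ (diag_mx _)).
  by rewrite [RHS]scalemxAr scale_col_mx scaler0.
have := enorm_homogeneous_opnorm K0 T_bounded T_homogeneous (col_mx 0 (iIm q)).
by rewrite Tnorm col_mxKd iIm_idem enorm_col0.
Qed.

(** Omega is block diagonal, so it preserves the norm of each block: the rotated
    graph inherits from the graph that x controls (x, A^* x). *)
Lemma proj_x_part_bound (K : R) :
  (forall x, enorm (graph_mx A *m x) <= K * enorm x) ->
  forall v, enorm (P *m v) <= K * enorm (usubmx (P *m v)).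
Proof.
move=> AK v; pose x := (invmx L)^t* *m (B *m v).
have PE : P *m v = Om^t* *m (graph_mx A *m x).
  by rewrite /x /Bmx trmxC_mul (Cmx_trmxC A L) !mulmxA.
have -> : enorm (usubmx (P *m v)) = enorm x.
  rewrite PE /graph_mx mul_col_mx mul1mx trmxC_Omega mul_block_col col_mxKu.
  rewrite mul0mx addr0 enorm_isometry // trmxCK.
  exact/mulmx1C/Omega_x_isometry.
by rewrite PE enorm_isometry ?trmxCK ?Omega_unitary.
Qed.

Hypothesis theta_null : A *m hmul (toC theta) u = 0.

(** The points of F differ from the solution by a vector orthogonal to the graph
    ([proj_theta]). *)
Lemma zstarE : zstar A b xnat a theta =
  a *: znat A xnat + col_mx 0 (a *: hmul (toC theta) u).
Proof.
rewrite /zstar /znat scale_col_mx add_col_mx addr0 -scalerDr.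
congr (col_mx _ (_ *: _)); rewrite [X in X + _](ynatE xnat_sol b_gt0).
apply/matrixP => i j; rewrite /ystar; move: u => w; rewrite !mxE.
by rewrite rmorphD mulrDl.
Qed.

Lemma proj_znat : C^t* *m (C *m znat A xnat) = znat A xnat.
Proof.
by apply: Cmx_proj_graph => //; rewrite /graph /znat /= col_mxKu col_mxKd.
Qed.

Lemma proj_theta : C *m col_mx 0 (a *: hmul (toC theta) u) = 0.
Proof.
rewrite mul_row_col mulmx0 add0r -scalemxAr -mulmxA theta_null.
by rewrite mulmx0 scaler0.
Qed.

Variables (noise : 'cV[R]_m) (z : 'cV[R[i]]_(n + m)).
Let v := vvec A b xnat z a theta.
Let q := dsubmx v.

(** The phase of the second block of z, relative to that of the solution. *)
Definition unit_phase : 'cV[R[i]]_m :=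
  phase (toC (b + theta) + q).

Definition prox_displacement : 'cV[R[i]]_m :=
  hmul (toC (b + noise)) unit_phase - toC b.

Lemma prox_rotated :
  col_mx (usubmx z) (prox_f (b + noise) (dsubmx z)) =
  a *: znat A xnat + Om *m col_mx (usubmx v) prox_displacement.
Proof.
have usubE : Omega_x xnat a *m usubmx v = usubmx z - a *: xnat.
  have : usubmx (Om *m v) = usubmx (z - zstar A b xnat a theta).
    by rewrite Omega_vvec.
  rewrite [RHS]linearB [X in _ = _ - X]col_mxKu => <-.
  move: v => v'; rewrite -[in RHS](vsubmxK v') mul_block_col mul0mx addr0.
  by rewrite col_mxKu.
rewrite mul_block_col !mul0mx add0r addr0 usubE.
rewrite /znat scale_col_mx add_col_mx (addrC (a *: xnat)) subrK; congr col_mx.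
rewrite Omega_yE // mul_diag_hmul; apply/matrixP => i j; rewrite (ord1 j).
rewrite [prox_f _ _ i 0]mxE [phase (dsubmx z) i 0]mxE.
rewrite (dsubmx_Omega xnat_sol b_gt0 a1 s_gt0).
rewrite phase_mul_unimodular; last first.
  by rewrite normrM a1 (norm_phase_ynat xnat_sol b_gt0) mul1r.
have := ynatE xnat_sol b_gt0; rewrite /prox_displacement /unit_phase -/v -/q.
move: u q => w q' ->.
by rewrite !mxE; set t := _ / _; ring.
Qed.

(** In rotated coordinates p is the solution plus (v_x, [prox_displacement]),
    and the part of zs orthogonal to the graph cancels between z and zs.  The
    rest is [enorm_split_reflection]. *)
Lemma douglas_rachford_error :
  enorm (douglas_rachford A L (b + noise) z - zstar A b xnat a theta) =
  enorm (P *m v + col_mx 0 (prox_displacement - q)).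
Proof.
have PPi : Om *m P = C^t* *m (C *m Om).
  by rewrite /Bmx trmxC_mul !mulmxA Omega_unitary mul1mx.
have -> : col_mx 0 (prox_displacement - q) =
          col_mx (usubmx v) prox_displacement - v.
  transitivity (col_mx (usubmx v) prox_displacement - col_mx (usubmx v) q).
    by rewrite opp_col_mx add_col_mx subrr.
  by rewrite vsubmxK.
rewrite -enorm_split_reflection ?proj_herm ?proj_idem //.
rewrite -[RHS](enorm_isometry (M := Om)) ?Omega_isometry //; congr enorm.
have zE : z = Om *m v + (a *: znat A xnat + col_mx 0 (a *: hmul (toC theta) u)).
  by rewrite -zstarE (Omega_vvec xnat_sol b_gt0 a1 s_gt0) subrK.
rewrite /douglas_rachford prox_rotated zstarE; set G := col_mx (usubmx v) _.
set T := col_mx 0 (a *: _) in zE *.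
have CT : C *m T = 0 by exact: proj_theta.
have linPi (X1 X2 X4 : 'cV_(n + m)) : C^t* *m (C *m (2%:R *: (X2 + X4) -
    (X1 + (X2 + T)))) = (C^t* *m (C *m X2)) + 2%:R *: (C^t* *m (C *m X4)) -
    C^t* *m (C *m X1).
  rewrite !(mulmxDr, mulmxBr, mulmxN, scalerDr) -!scalemxAr CT mulmx0 addr0.
  move: (C^t* *m (C *m X1)) (C^t* *m (C *m X2)) (C^t* *m (C *m X4)).
  by move=> Y1 Y2 Y4; apply/matrixP => i j; rewrite !mxE; ring.
rewrite zE linPi -!scalemxAr proj_znat.
have -> : C^t* *m (C *m (Om *m v)) = Om *m (P *m v).
  by rewrite (mulmxA _ P) PPi !mulmxA.
have -> : C^t* *m (C *m (Om *m G)) = Om *m (P *m G).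
  by rewrite (mulmxA _ P) PPi !mulmxA.
rewrite mulmxDr !mulmxBl !mul1mx -scalemxAl !mulmxBr -scalemxAr.
clear zE linPi CT.
move: (Om *m v) (Om *m G) (Om *m (P *m v)) (Om *m (P *m G)) (a *: _) T.
by move=> X1 X2 X3 X4 X5 X6; apply/matrixP => i j; rewrite !mxE; ring.
Qed.

End OneStep.

(** * Contraction of one step *)

Lemma enorm_le_entrywise (R : realType) p (K : R) (w z : 'cV[R[i]]_p) :
  0 <= K -> (forall i, cabs (w i 0) <= K * cabs (z i 0)) ->
  enorm w <= K * enorm z.
Proof.
move=> K0 wz; apply: enorm_le_sq => //; rewrite !enorm_sqE mulr_sumr.
apply: ler_sum => i _; rewrite -exprMn ler_sqr ?nnegrE ?cabs_ge0 //.
by rewrite mulr_ge0 ?cabs_ge0.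
Qed.

Lemma enormR_toC (R : realType) p (w : 'cV[R]_p) : enormR w = enorm (toC w).
Proof.
rewrite /enormR /enorm; congr Num.sqrt; apply: eq_bigr => i _.
by rewrite mxE cabsr real_normK ?num_real.
Qed.

Lemma bmin_le (R : realType) m (b : 'cV[R]_m) i : bmin b <= b i 0.
Proof.
apply: ge_inf; last by exists i.
exists (- \sum_j `|b j 0|) => _ [j _ <-].
rewrite lerNl (le_trans (ler_norm _)) // normrN (bigD1 j) //= lerDl.
by rewrite sumr_ge0.
Qed.

Lemma dist_le (R : realType) p (x y : 'cV[R[i]]_p) (a : R[i]) :
  `|a| = 1 -> dist x y <= enorm (x - a *: y).
Proof.
move=> a1; apply: ge_inf; last by exists a.
by exists 0 => _ [c _ <-]; apply: enorm_ge0.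
Qed.

Section Contraction.
Variables (R : realType) (n m : nat) (A : 'M[R[i]]_(n, m)) (b : 'cV[R]_m).
Variables (xnat : 'cV[R[i]]_n) (L : 'M[R[i]]_n) (a : R[i]) (theta : 'cV[R]_m).
Hypothesis hL : is_cholesky (1%:M + A *m A^t*) L.
Hypothesis xnat_sol : phase_retrieval_sol A b xnat.
Hypothesis b_gt0 : forall i, 0 < b i 0.
Hypothesis a1 : `|a| = 1.

(** Two points on the circles of radii s and b are at least |s - b| apart; this
    makes the bound eps2 on the distance to the solution one on theta. *)
Lemma theta_le_dist : (forall i, 0 <= b i 0 + theta i 0) ->
  enormR theta <= enorm (zstar A b xnat a theta - znat A xnat).
Proof.
move=> s_ge0; rewrite enormR_toC.
apply: le_trans (enorm_dsubmx_le _); rewrite -[leRHS]mul1r.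
apply: enorm_le_entrywise => // i; rewrite mul1r mxE cabsr.
rewrite /zstar /znat opp_col_mx add_col_mx col_mxKd.
rewrite [X in _ - X](ynatE xnat_sol b_gt0).
have := norm_phase_ynat xnat_sol b_gt0 i; rewrite /ystar.
move: (phase _) => w w1; rewrite !mxE.
have -> : a * ((b i 0 + theta i 0)%:C * w i 0) - (b i 0)%:C * w i 0 =
  (a * (b i 0 + theta i 0)%:C - (b i 0)%:C) * w i 0 by ring.
rewrite cabsM [cabs (w i 0)]/cabs w1 mulr1.
rewrite -ler_sqr ?nnegrE ?cabs_ge0 // cabs_sq real_normK ?num_real //.
have := cabs_sq a; rewrite /cabs a1 /= expr1n.
have := s_ge0 i; have := b_gt0 i.
move: (b i 0) (theta i 0) => B T; case: (a) => x y /= B0 S0 xy.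
have x1 : x <= 1 by nra.
have : 0 <= (B + T) * B * (1 - x) by rewrite !mulr_ge0 ?(ltW B0) // subr_ge0.
have e : (x * (B + T) - y * 0 - B) ^+ 2 + (x * 0 + y * (B + T) - 0) ^+ 2 =
  (x ^+ 2 + y ^+ 2) * (B + T) ^+ 2 + B ^+ 2 - 2 * x * ((B + T) * B) by ring.
rewrite /= ?oppr0 in e *; rewrite e -xy; nra.
Qed.

Variables (beta eps1 kappa c bm : R).
Hypotheses (bm_gt0 : 0 < bm) (bm_le : forall i, bm <= b i 0).
Hypothesis theta_le : forall i, `|theta i 0| <= bm / 3.

Let s_ge i : 2 / 3 * b i 0 <= b i 0 + theta i 0.
Proof. have := theta_le i; have := bm_le i; rewrite ler_norml => *; lra. Qed.

Let s_gt0 i : 0 < b i 0 + theta i 0.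
Proof. by have := s_ge i; have := b_gt0 i; lra. Qed.

Variables (noise : 'cV[R]_m) (z : 'cV[R[i]]_(n + m)).
Local Notation v := (vvec A b xnat z a theta).
Local Notation q := (dsubmx v).
Local Notation w := (unit_phase A b xnat a theta z).
Local Notation P := ((Bmx A b xnat L a theta)^t* *m Bmx A b xnat L a theta).

Hypothesis v_small : enorm v <= bm / 3.

(** The second order error of the phase, weighted by the magnitudes. *)
Definition prox_remainder : 'cV[R[i]]_m := \col_i ((b i 0)%:C *
  (w i 0 - 1 - 'i * (complex.Im (q i 0) / (b i 0 + theta i 0))%:C)).

Lemma prox_displacementE :
  prox_displacement A b xnat a theta noise z - q =
  (- re_part q + hmul (quot_shift b theta) (iIm q)) +
  (prox_remainder + hmul (toC noise) w).
Proof.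
rewrite {1}[q]re_iIm /prox_displacement /prox_remainder.
move: w => W; move: q => Q; apply/matrixP => i j; rewrite (ord1 j) !mxE.
move: (W i 0) (b i 0) (theta i 0) (noise i 0) => t B T N.
rewrite (rmorphB _ _ 1) !rmorphD !rmorphM /= fmorphV rmorphD rmorph1.
by ring.
Qed.

Let q_small i : cabs (q i 0) <= (b i 0 + theta i 0) / 2.
Proof.
have qv : cabs (q i 0) <= enorm v.
  exact: le_trans (cabs_le_enorm q i) (enorm_dsubmx_le _).
apply: (le_trans qv); apply: (le_trans v_small).
by have := s_ge i; have := bm_le i; lra.
Qed.

Let wE i : w i 0 = ((b i 0 + theta i 0)%:C + q i 0) /
  `|(b i 0 + theta i 0)%:C + q i 0|.
Proof. by rewrite /unit_phase; move: q => Q; rewrite !mxE. Qed.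

Lemma enorm_noise_term : enorm (hmul (toC noise) w) <= enormR noise.
Proof.
rewrite enormR_toC -[leRHS]mul1r; apply: enorm_le_entrywise => // i.
rewrite [hmul _ _ i 0]mxE cabsM mul1r ler_piMr ?cabs_ge0 // wE.
have [+ _] := phase_second_order (s_gt0 i) (q_small i).
move: (_%:C + _) => Z Z0; rewrite /cabs norm_phase //.
apply: contraTneq Z0 => ->; rewrite /cabs normr0 /= -ltNge.
by rewrite divr_gt0 ?s_gt0.
Qed.

(** From |theta| <= bm / 3 follows s >= 2 b / 3, so that the factor 3 b / s^2
    of the scalar estimate is at most 27 / (4 b). *)
Lemma enorm_remainder : enorm prox_remainder <= 27 / (4 * bm) * enorm v ^+ 2.
Proof.
have K0 : 0 <= 27 / (4 * bm) by rewrite divr_ge0 ?mulr_ge0 ?(ltW bm_gt0).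
have qv := enorm_dsubmx_le v.
apply: (@le_trans _ _ (27 / (4 * bm) * enorm v * enorm q)); last first.
  by rewrite expr2 mulrA ler_wpM2l // mulr_ge0 ?enorm_ge0.
apply: enorm_le_entrywise => [|i]; first by rewrite mulr_ge0 ?enorm_ge0.
rewrite [prox_remainder i 0]mxE cabsM cabsr wE gtr0_norm //.
have [_ h] := phase_second_order (s_gt0 i) (q_small i).
apply: le_trans (ler_wpM2l (ltW (b_gt0 i)) h) _.
rewrite [cabs _ ^+ 2]expr2 !mulrA ler_wpM2r ?cabs_ge0 //.
apply: ler_pM; rewrite ?cabs_ge0 //.
- by rewrite mulr_ge0 ?invr_ge0 ?sqr_ge0 // mulr_ge0 // ltW.
- rewrite ler_pdivrMr ?exprn_gt0 // mulrAC ler_pdivlMr ?mulr_gt0 //.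
  have := s_ge i; have := bm_le i; have := b_gt0 i.
  move: (b i 0) (b i 0 + theta i 0) => B S B0 Bb SB.
  have : (2 / 3 * B) ^+ 2 <= S ^+ 2 by rewrite ler_sqr ?nnegrE //; lra.
  have : B * bm <= B * B by rewrite ler_wpM2l // ltW.
  rewrite exprMn; lra.
- exact: le_trans (cabs_le_enorm q i) _.
Qed.

(** The x-block is untouched by e, and P v is controlled by its x-block: this is
    the situation of [rate_gap]. *)
Lemma linear_part_gap :
  rate_gap beta eps1 kappa c ->
  enorm (J0 A b xnat L a theta v) <= beta * enorm v ->
  opnorm (fun v => Jk A b xnat L a theta v - J0 A b xnat L a theta v) <= eps1 ->
  (forall x, enorm (graph_mx A *m x) <= kappa * enorm x) ->
  enorm (P *m v + col_mx 0 (- re_part q + hmul (quot_shift b theta) (iIm q)))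
    <= (beta + eps1 - c) * enorm v.
Proof.
move=> gap; rewrite (enorm_J0 hL xnat_sol b_gt0 a1 s_gt0) => hJ0 hJk hk.
set t := P *m v; set e := hmul _ _.
have tx := proj_x_part_bound L xnat_sol b_gt0 a1 s_gt0 hk v; rewrite -/t in tx.
have split_t y : t + col_mx 0 y = col_mx (usubmx t) (dsubmx t + y).
  by rewrite -{1}(vsubmxK t) add_col_mx addr0.
have J0E : t - col_mx 0 (re_part q) = t + col_mx 0 (- re_part q).
  by rewrite opp_col_mx oppr0.
rewrite J0E in hJ0.
apply: (gap (enorm v) (enorm (iIm q)) (enorm (re_part q))
  (enorm (t + col_mx 0 (- re_part q))) (enorm (usubmx t))
  (enorm (dsubmx t - re_part q)) (enorm e)); rewrite ?enorm_ge0 //.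
- by rewrite split_t enorm_col_mx.
- apply: le_trans (quot_shift_opnorm hL xnat_sol b_gt0 a1 s_gt0 q) _.
  by rewrite ler_wpM2r ?enorm_ge0.
- by rewrite addrC -enorm_re_iIm ler_sqr ?nnegrE ?enorm_ge0 // enorm_dsubmx_le.
- apply: le_trans (enormD _ _) _; rewrite lerD //.
  by rewrite enorm_col0 enormN.
- have -> : col_mx (0 : 'cV_n) (- re_part q + e) =
            col_mx 0 (- re_part q) + col_mx 0 e by rewrite add_col_mx addr0.
  by rewrite addrA (le_trans (enormD _ _)) // enorm_col0.
- rewrite split_t enorm_col_mx lerD2l addrA.
  rewrite ler_sqr ?nnegrE ?addr_ge0 ?enorm_ge0 //.
  exact: enormD.
Qed.

End Contraction.

(** * Iterating the contraction *)

Section Iteration.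
Variables (R : realType) (n m : nat) (A : 'M[R[i]]_(n, m)) (bt : 'cV[R]_m).
Variables (x lam xh : nat -> 'cV[R[i]]_n) (y nu yh : nat -> 'cV[R[i]]_m).
Hypothesis gps : gps_iteration A bt x lam xh y nu yh.
Let zDR k := col_mx (lam k + x k) (nu k + y k).

(** With g = 0 the x-update has no proximal step, so x_k is the first block of
    zDR_k. *)
Lemma gps_lam0 k : lam k.+1 = 0.
Proof. by rewrite (gps_lam gps) (gps_x gps) [xh k + _]addrC subrr. Qed.

Lemma gps_DR_step k L : is_cholesky (1%:M + A *m A^t*) L ->
  zDR k.+2 = douglas_rachford A L bt (zDR k.+1).
Proof.
move=> hL; rewrite /douglas_rachford; set p := col_mx _ (prox_f _ _).
have xyE : col_mx (x k.+1) (y k.+1) = p.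
  rewrite /p /zDR col_mxKu col_mxKd gps_lam0 add0r; congr (col_mx _ _).
  by rewrite (gps_nu gps) subrK (gps_y gps) addrC.
have zhE := orth_proj_graphE hL (gps_proj gps k.+1).
have -> : 2%:R *: p - zDR k.+1 =
          col_mx (x k.+1 - lam k.+1) (y k.+1 - nu k.+1).
  rewrite -xyE /zDR scale_col_mx opp_col_mx add_col_mx !scaler_nat !mulr2n.
  by congr col_mx; rewrite opprD addrCA addrK addrC.
rewrite -zhE -xyE /zDR opp_col_mx !add_col_mx addrK addrK; congr col_mx.
  by rewrite (gps_lam gps k.+1) subrK.
by rewrite (gps_nu gps k.+1) subrK.
Qed.

End Iteration.

(** The recursion is only available below the threshold [bnd], and the bound
    itself keeps [e] below it; (1 - rho)^-1 * noise is the fixed point of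
    t |-> rho t + noise. *)
Lemma perturbed_geometric (R : realType) (rho noise e1 bnd : R) (e : nat -> R) :
  0 <= rho < 1 -> 0 <= noise -> 0 <= e1 -> 
  e1 + (1 - rho)^-1 * noise <= bnd -> e 0%N <= e1 ->
  (forall k, e k <= bnd -> e k.+1 <= rho * e k + noise) ->
  forall k, e k <= rho ^+ k * e1 + (1 - rho)^-1 * noise.
Proof.
move=> /andP[rho0 rho1] noise0 e10 hbnd he0 step.
have inv0 : 0 < (1 - rho)^-1 by rewrite invr_gt0 subr_gt0.
have fix_pt : rho * ((1 - rho)^-1 * noise) + noise = (1 - rho)^-1 * noise.
  by field; rewrite subr_eq0 eq_sym lt_eqF.
have tail0 : 0 <= (1 - rho)^-1 * noise by rewrite mulr_ge0 // ltW.
elim=> [|k IH]; first by rewrite expr0 mul1r; lra.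
have rk : rho ^+ k * e1 <= e1 by rewrite ler_piMl // exprn_ile1 // ltW.
apply: le_trans (step k _) _; first by lra.
have := ler_wpM2l rho0 IH; rewrite exprS -mulrA mulrDr; lra.
Qed.

Theorem theorem3p6 (R : realType) (n m : nat) (hnm : (n <= m)%N)
  (A : 'M[R[i]]_(n, m)) (b : 'cV[R]_m) (hb : 0 < bmin b)
  (G : finZmodType) (grid : 'I_n -> G) (hgrid : bijective grid)
  (xnat : 'cV[R[i]]_n) (hA : assumption1 A b grid xnat)
  (L : 'M[R[i]]_n) (hL : is_cholesky (1%:M + A *m A^t*) L)
  (beta eps1 eps2 : R)
  (hbeta : 0 < beta < 1) (heps1 : 0 < eps1) (hrate : beta + eps1 < 1)
  (heps2 : 0 < eps2 < bmin b / 3%:R) :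
  exists delta : R, 0 < delta /\
  forall (noise : 'cV[R]_m)
    (x lam xh : nat -> 'cV[R[i]]_n) (y nu yh : nat -> 'cV[R[i]]_m)
    (alpha : nat -> R[i]) (theta : nat -> 'cV[R]_m),
  let zDR := fun k => col_mx (lam k + x k) (nu k + y k) in
  let zs := fun k => zstar A b xnat (alpha k) (theta k) in
  gps_iteration A (b + noise) x lam xh y nu yh ->
  (forall k, is_F_proj A b xnat (zDR k) (alpha k) (theta k)) ->
  (* beta is a local contraction constant *)
  (forall k, (1 <= k)%N -> Vball A b xnat (alpha k) (zDR k) ->
     let v := vvec A b xnat (zDR k) (alpha k) (theta k) in
     enorm (J0 A b xnat L (alpha k) (theta k) v) <= beta * enorm v) ->
  (* choice of eps2 in terms of eps1 *)
  (forall k, (1 <= k)%N -> enormR (theta k) <= eps2 ->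
     opnorm (fun v => Jk A b xnat L (alpha k) (theta k) v
                      - J0 A b xnat L (alpha k) (theta k) v) <= eps1) ->
  enorm (zDR 1%N - zs 1%N) < delta ->
  enormR noise < enorm (zDR 1%N - zs 1%N) ->
  (forall k, (1 <= k)%N -> Vball A b xnat (alpha k) (zDR k)) ->
  (forall k, (1 <= k)%N -> enorm (zs k - znat A xnat) <= eps2) ->
  forall k, (1 <= k)%N ->
    dist (x k) xnat <=
      (beta + eps1) ^+ k.-1 * enorm (zDR 1%N - zs 1%N)
      + (1 - (beta + eps1))^-1 * enormR noise.
Proof.
have xsol := phase_retrieval_ex hA.
have bm_le := bmin_le b.
have b_gt0 i : 0 < b i 0 by apply: lt_le_trans hb (bm_le i).
have /andP[beta0 beta1] := hbeta.
have /andP[eps20 eps2b] := heps2.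
have [K K0 AK] := enorm_mulmx_bounded (graph_mx A).
have AK1 v : enorm (graph_mx A *m v) <= (K + 1) * enorm v.
  by rewrite (le_trans (AK v)) // ler_wpM2r ?enorm_ge0 // lerDl.
have K1 : 1 <= K + 1 by rewrite lerDr.
have [c c0 gap] := strict_rate_gap beta0 heps1 K1.
set rho := beta + eps1 in hrate *.
have rho0 : 0 < rho by rewrite addr_gt0.
(* The second bound absorbs the quadratic remainder into the gap c; the first
   keeps q below s / 2, away from the singularity of the phase. *)
pose r := Num.min (bmin b / 3%:R) (c / (27 / (4 * bmin b))).
have r0 : 0 < r by rewrite lt_min !divr_gt0 ?mulr_gt0.
have inv0 : 0 < (1 - rho)^-1 by rewrite invr_gt0 subr_gt0.
(* The noise is smaller than e_1, so e_1 + noise / (1 - rho) < r. *)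
exists (r / (1 + (1 - rho)^-1)); split; first by rewrite divr_gt0 // addr_gt0.
move=> noise x lam xh y nu yh alpha theta zDR zs gps proj hJ0 hJk.
rewrite ltr_pdivlMr ?addr_gt0 // => e1_small noise_small ball zs_near.
have a1 k : `|alpha k| = 1 by case: (proj k) => -[].
have step k : enorm (zDR k.+1 - zs k.+1) <= r ->
    enorm (zDR k.+2 - zs k.+2) <=
    rho * enorm (zDR k.+1 - zs k.+1) + enormR noise.
  move=> e_small; set a := alpha k.+1; set th := theta k.+1.
  have [[_ th_null s_ge0] _] := proj k.+1.
  have th_eps : enormR th <= eps2.
    exact: le_trans (theta_le_dist xsol b_gt0 (a1 _) s_ge0) (zs_near k.+1 _).
  have th_le i : `|th i 0| <= bmin b / 3%:R.
    rewrite -cabsr (le_trans _ (le_trans th_eps (ltW eps2b))) // enormR_toC.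
    by rewrite (le_trans _ (cabs_le_enorm _ i)) // mxE.
  have s_gt0 i : 0 < b i 0 + th i 0.
    have := th_le i; have := bm_le i; rewrite ler_norml => h /andP[h1 h2].
    by move: hb h h1; clear; lra.
  have vE : enorm (vvec A b xnat (zDR k.+1) a th) = enorm (zDR k.+1 - zs k.+1).
    exact: (enorm_vvec xsol b_gt0 (a1 k.+1) s_gt0).
  have [r1 r2] : r <= bmin b / 3%:R /\ r <= c / (27 / (4 * bmin b)).
    by rewrite !ge_min !lexx orbT.
  have v_small : enorm (vvec A b xnat (zDR k.+1) a th) <= bmin b / 3%:R.
    by rewrite vE (le_trans e_small).
  have lin := linear_part_gap hL xsol b_gt0 (a1 k.+1) bm_le th_le gap
    (hJ0 k.+1 isT (ball k.+1 isT)) (hJk k.+1 isT th_eps) AK1.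
  have rem := enorm_remainder b_gt0 hb bm_le th_le v_small.
  have ns := enorm_noise_term b_gt0 bm_le th_le noise v_small.
  have Fk : Fset A b xnat (zs k.+1).
    by exists a, th; split=> //; case: (proj k.+1).
  rewrite [leLHS]enorm_distC; apply: le_trans ((proj k.+2).2 _ Fk) _.
  rewrite enorm_distC.
  have -> : zDR k.+2 = douglas_rachford A L (b + noise) (zDR k.+1).
    exact (gps_DR_step gps k hL).
  rewrite (douglas_rachford_error hL xsol b_gt0 (a1 k.+1) s_gt0 th_null).
  rewrite prox_displacementE.
  rewrite -[X in col_mx X _]addr0 -add_col_mx addrA.
  apply: le_trans (enormD _ _) _; rewrite enorm_col0.
  have rem_c : 27 / (4 * bmin b) * enorm (vvec A b xnat (zDR k.+1) a th) ^+ 2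
               <= c * enorm (vvec A b xnat (zDR k.+1) a th).
    rewrite expr2 mulrA ler_wpM2r ?enorm_ge0 // vE mulrC.
    by rewrite -ler_pdivlMr ?divr_gt0 ?mulr_gt0 // (le_trans e_small).
  have := enormD (prox_remainder A b xnat a th (zDR k.+1))
    (hmul (toC noise) (unit_phase A b xnat a th (zDR k.+1))).
  by rewrite -vE; move: lin rem ns rem_c; rewrite -/rho; clear; lra.
have noise0 : 0 <= enormR noise by apply: sqrtr_ge0.
have e10 : 0 <= enorm (zDR 1%N - zs 1%N) by apply: enorm_ge0.
have bound := @perturbed_geometric R rho (enormR noise)
  (enorm (zDR 1%N - zs 1%N)) r (fun k => enorm (zDR k.+1 - zs k.+1)).
case=> // k _; apply: (@le_trans _ _ (enorm (zDR k.+1 - zs k.+1))).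
  apply: le_trans (dist_le _ _ (a1 k.+1)) _.
  rewrite -[x k.+1](_ : usubmx (zDR k.+1) = _); last first.
    by rewrite col_mxKu (gps_lam0 gps) add0r.
  have -> : alpha k.+1 *: xnat = usubmx (zs k.+1) by rewrite col_mxKu.
  rewrite -linearB; exact: enorm_usubmx_le.
apply: bound => //; first by rewrite ltW.
have : (1 - rho)^-1 * enormR noise <=
       (1 - rho)^-1 * enorm (zDR 1%N - zs 1%N).
  by rewrite ler_wpM2l // ltW.
by move: e1_small; clear; lra.
Qed.
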